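(* Let $R$ be a ring. Given a class $\mathcal{C}$ of cyclic right $R$-modules that is closed under extensions, the family $\mathcal{F}_{\mathcal{C}}:=\{I : I \text{ is a right ideal of } R \text{ with } R/I\in\mathcal{C}\}$ is an Oka family of right ideals in $R$. Conversely, given a right Oka family $\mathcal{F}$ in $R$, the class $\mathcal{C}_{\mathcal{F}}:=\{M : M \text{ is a right } R\text{-module with } M\cong R/I \text{ for some } I\in\mathcal{F}\}$ of cyclic right $R$-modules is closed under extensions.
   Context: Rings are associative with $1$, modules are unital. For a right ideal $I$ of $R$ and $a\in R$, put $a^{-1}I:=\{r\in R: ar\in I\}$, a right ideal of $R$. An Oka family of right ideals (right Oka family) in $R$ is a family $\mathcal{F}$ of right ideals of $R$ with $R\in\mathcal{F}$ such that for every right ideal $I$ of $R$ and every $a\in R$: if $I+aR\in\mathcal{F}$ and $a^{-1}I\in\mathcal{F}$, then $I\in\mathcal{F}$. A class $\mathcal{C}$ of cyclic right $R$-modules with $0\in\mathcal{C}$ is closed under extensions if for every short exact sequence $0\to L\to M\to N\to 0$ in which $L$, $M$ and $N$ are all cyclic right $R$-modules, whenever $L,N\in\mathcal{C}$ it follows that $M\in\mathcal{C}$. (The requirement $0\in\mathcal{C}$ is part of the definition.) *)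

(* Defs.v *)
From HB Require Import structures.
From mathcomp Require Import all_boot all_order all_algebra.
From mathcomp Require Import ring_quotient generic_quotient.
From mathcomp Require Import boolp.

Set Implicit Arguments.
Unset Strict Implicit.
Unset Printing Implicit Defensive.

Import GRing.Theory.
Local Open Scope ring_scope.
Local Open Scope quotient_scope.

(* A right R-module is a left module over the opposite ring R^c; in it, r *: m
   is the right action m . r. [pzRingType] (instead of [nzRingType]) does not
   exclude the zero ring. *)
Definition rmodType (R : pzRingType) := lmodType R^c.

(* R as a right module over itself: here r *: x is the product x * r of R. *)
Definition right_regular (R : pzRingType) : rmodType R := (R^c)^o.

Lemma right_regular_scaleE (R : pzRingType) (r : R^c) (x : right_regular R) :
  r *: x = (x : R) * (r : R) :> R.
Proof. by []. Qed.

(* Membership in a [submodClosed] is boolean; by [boolp.asbool] every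
   Prop-valued submodule gives rise to one. *)
Definition rightIdeal (R : pzRingType) := submodClosed (right_regular R).

Section QuotientModule.
Variables (K : pzRingType) (V : lmodType K) (I : submodClosed V).

(* [submodClosed] does not inherit from [zmodClosed] in the hierarchy (it is
   declared over semirings), so the opposite-closure is supplied here. *)
Definition zmod_of_submod : {pred V} := I.

HB.instance Definition _ :=
  GRing.isZmodClosed.Build V zmod_of_submod
    (GRing.submod_closedB (submodClosedP I)).

Definition quotmod : Type := Quotient.quot zmod_of_submod.

HB.instance Definition _ := GRing.Zmodule.on quotmod.
HB.instance Definition _ := EqQuotient.on quotmod.

Definition quotmod_scale (r : K) : quotmod -> quotmod :=
  fun x => \pi_quotmod (r *: repr x).

Lemma pi_quotmodE (u v : V) :
  (\pi_quotmod u == \pi_quotmod v) = (u - v \in I).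
Proof. exact: (esym (Quotient.idealrBE zmod_of_submod u v)). Qed.

Lemma pi_quotmodD (u v : V) :
  \pi_quotmod (u + v) = \pi_quotmod u + \pi_quotmod v.
Proof. exact: (Quotient.pi_add zmod_of_submod u v). Qed.

Lemma pi_quotmod_scale r (v : V) :
  quotmod_scale r (\pi_quotmod v) = \pi_quotmod (r *: v).
Proof.
apply/eqP; rewrite pi_quotmodE -scalerBr rpredZ //.
by rewrite -pi_quotmodE reprK.
Qed.

Lemma quotmod_scalerA a b x :
  quotmod_scale a (quotmod_scale b x) = quotmod_scale (a * b) x.
Proof.
by elim/quotW: x => v; rewrite (pi_quotmod_scale b) !pi_quotmod_scale scalerA.
Qed.

Lemma quotmod_scale1r : left_id 1 quotmod_scale.
Proof. by elim/quotW=> v; rewrite pi_quotmod_scale scale1r. Qed.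

Lemma quotmod_scalerDr : right_distributive quotmod_scale +%R.
Proof.
move=> a; elim/quotW=> u; elim/quotW=> v.
by rewrite -pi_quotmodD !pi_quotmod_scale scalerDr pi_quotmodD.
Qed.

Lemma quotmod_scalerDl x :
  {morph quotmod_scale^~ x : a b / a + b}.
Proof.
move=> a b; elim/quotW: x => v; rewrite !pi_quotmod_scale.
by rewrite scalerDl pi_quotmodD.
Qed.

HB.instance Definition _ := GRing.Zmodule_isLmodule.Build K quotmod
  quotmod_scalerA quotmod_scale1r quotmod_scalerDr quotmod_scalerDl.

End QuotientModule.

Definition ring_mod (R : pzRingType) (I : rightIdeal R) : rmodType R :=
  quotmod I.

Section RightIdeals.
Variable R : pzRingType.

Definition ideal_top : {pred right_regular R} := predT.

Lemma ideal_top_submod : submod_closed ideal_top.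
Proof. by []. Qed.

HB.instance Definition _ :=
  GRing.isSubmodClosed.Build R^c (right_regular R) ideal_top ideal_top_submod.

Variables (I : rightIdeal R) (a : R).

Definition ideal_add : {pred right_regular R} :=
  [pred x : R | `[< exists i r : R, i \in I /\ x = i + a * r >]].

Lemma ideal_add_submod : submod_closed ideal_add.
Proof.
split=> [|c u v /asboolP[i [r [Ii ->]]] /asboolP[j [s [Ij ->]]]]; apply/asboolP.
  by exists 0, 0; rewrite mulr0 addr0; split=> //; apply: rpred0.
exists ((i : R) * (c : R) + j), (r * (c : R) + s); split.
  have := rpredD (rpredZ c Ii) Ij; exact.
by rewrite right_regular_scaleE mulrDl mulrDr mulrA addrACA.
Qed.

HB.instance Definition _ :=
  GRing.isSubmodClosed.Build R^c (right_regular R) ideal_add ideal_add_submod.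

(* a^{-1}I = {r | ar \in I} *)
Definition ideal_inv : {pred right_regular R} :=
  [pred r : R | (a * r : R) \in I].

Lemma ideal_inv_submod : submod_closed ideal_inv.
Proof.
split=> [|c u v]; rewrite !inE; first by rewrite mulr0; apply: rpred0.
move=> Iu Iv; rewrite right_regular_scaleE mulrDr mulrA.
have := rpredD (rpredZ c Iu) Iv; exact.
Qed.

HB.instance Definition _ :=
  GRing.isSubmodClosed.Build R^c (right_regular R) ideal_inv ideal_inv_submod.

End RightIdeals.

Arguments ideal_top : clear implicits.

Definition right_oka (R : pzRingType) (F : rightIdeal R -> Prop) : Prop :=
  F (ideal_top R : rightIdeal R) /\
  forall (I : rightIdeal R) (a : R),
    F (ideal_add I a : rightIdeal R) -> F (ideal_inv I a : rightIdeal R) -> F I.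

Definition zero_module (K : pzRingType) (M : lmodType K) : Prop :=
  forall m : M, m = 0.

Definition cyclic_module (K : pzRingType) (M : lmodType K) : Prop :=
  exists m : M, forall x : M, exists r : K, x = r *: m.

Definition module_iso (K : pzRingType) (M N : lmodType K) : Prop :=
  exists f : {linear M -> N}, bijective f.

(* exactness of 0 -> L -f-> M -g-> N -> 0 *)
Definition short_exact (K : pzRingType) (L M N : lmodType K)
    (f : {linear L -> M}) (g : {linear M -> N}) : Prop :=
  [/\ injective f,
      forall m : M, g m = 0 <-> exists l : L, f l = m
    & forall n : N, exists m : M, g m = n].

Definition cyclic_class (R : pzRingType) (C : rmodType R -> Prop) : Prop :=
  forall M : rmodType R, C M -> cyclic_module M.

(* The zero module is only determined up to isomorphism, so 0 \in C is read as:
   every zero module lies in C. *)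
Definition closed_under_extensions (R : pzRingType) (C : rmodType R -> Prop) :
    Prop :=
  (forall Z : rmodType R, zero_module Z -> C Z) /\
  forall (L M N : rmodType R) (f : {linear L -> M}) (g : {linear M -> N}),
    cyclic_module L -> cyclic_module M -> cyclic_module N ->
    short_exact f g -> C L -> C N -> C M.

Definition family_of_class (R : pzRingType) (C : rmodType R -> Prop) :
    rightIdeal R -> Prop :=
  fun I => C (ring_mod I).

Definition class_of_family (R : pzRingType) (F : rightIdeal R -> Prop) :
    rmodType R -> Prop :=
  fun M => exists2 I : rightIdeal R, F I & module_iso M (ring_mod I).

(* Main.v *)
From HB Require Import structures.
Require Import Defs.
From mathcomp Require Import all_boot all_order all_algebra.
From mathcomp Require Import generic_quotient boolp.

(** A cyclic module with generator [m] is [R / ann m], so both halves of the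
    theorem compare an Oka step on a right ideal [I] with a short exact sequence
    of cyclic modules.  The bridge is the sequence
      [0 -> R / a^-1 I -> R / I -> R / (I + aR) -> 0]
    whose first map is left multiplication by [a].  Since it is exact, a class
    of cyclic modules closed under extensions gives an Oka family.

    Conversely, let [0 -> L -> M -> N -> 0] be exact with maps [f] and [g], let
    [m] generate [M] and [l] generate [L], and write [f l = m a].  With
    [I = ann m] one finds [a^-1 I = ann l] and [I + aR = ann (g m)], and [g m]
    generates [N].  Hence [I] lies in an Oka family as soon as [ann l] and
    [ann (g m)] do.  What is known, however, is only that {e some} generator of
    [L], and of [N], has its annihilator in the family.  This is enough, because
    the Oka property already implies that membership of [ann x] does not depend
    on the generator [x] of a given module ([right_oka_generator]). *)

Set Implicit Arguments.
Unset Strict Implicit.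
Unset Printing Implicit Defensive.

Import GRing.Theory.
Local Open Scope ring_scope.
Local Open Scope quotient_scope.

(** * Submodules and maps out of quotient modules *)

(** Families of right ideals are predicates on bundled structures; this lets
    right ideals be compared by their elements. *)
Lemma submodClosed_ext (K : pzRingType) (V : lmodType K) (I J : submodClosed V) :
  I =i J -> I = J.
Proof.
case: I J => [P cP] [Q cQ] eqPQ.
have {}eqPQ : P = Q by apply: funext => x; apply: eqPQ.
case: Q / eqPQ cQ => cQ; congr GRing.SubmodClosed.Pack.
case: cP cQ => [[p1] [p2]] [[q1] [q2]].
by rewrite (Prop_irrelevance p1 q1) (Prop_irrelevance p2 q2).
Qed.

Lemma linear_of (K : pzRingType) (V W : lmodType K) (f : V -> W) :
  linear f -> {h : {linear V -> W} | h =1 f}.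
Proof.
move=> f_lin.
pose fL := GRing.isLinear.Build K V W _ f f_lin.
pose h : {linear V -> W} := HB.pack f fL.
by exists h.
Qed.

Lemma quotmod_lift (K : pzRingType) (V W : lmodType K) (I : submodClosed V)
    (phi : {linear V -> W}) :
  (forall v, v \in I -> phi v = 0) ->
  {h : {linear quotmod I -> W} | forall v, h (\pi_(quotmod I) v) = phi v}.
Proof.
move=> phiI.
have phiE v : phi (repr (\pi_(quotmod I) v)) = phi v.
  apply/eqP; rewrite -subr_eq0 -raddfB; apply/eqP/phiI.
  by rewrite -pi_quotmodE reprK.
have lin : linear (fun x : quotmod I => phi (repr x)).
  move=> c; elim/quotW=> u; elim/quotW=> v.
  have -> : c *: \pi_(quotmod I) u = \pi_(quotmod I) (c *: u).
    exact: pi_quotmod_scale.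
  by rewrite -pi_quotmodD !phiE linearP.
have [h hE] := linear_of lin.
by exists h => v; rewrite hE phiE.
Qed.

Lemma pi_quotmod_linear (K : pzRingType) (V : lmodType K) (I : submodClosed V) :
  linear (\pi_(quotmod I) : V -> quotmod I).
Proof. by move=> c u v; rewrite pi_quotmodD -pi_quotmod_scale. Qed.

Lemma pi_quotmod_eq0 (K : pzRingType) (V : lmodType K) (I : submodClosed V) v :
  (\pi_(quotmod I) v == 0) = (v \in I).
Proof.
have [h hE] := linear_of (@pi_quotmod_linear _ _ I).
have pi0 : \pi_(quotmod I) (0 : V) = 0 by rewrite -hE raddf0.
by rewrite -pi0 pi_quotmodE subr0.
Qed.

(** * Generators and annihilators *)

Definition generates (K : pzRingType) (M : lmodType K) (m : M) : Prop :=
  forall x : M, exists r : K, x = r *: m.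

Section Annihilator.
Variables (R : pzRingType) (M : rmodType R) (m : M).

Definition ann : {pred right_regular R} := [pred r : R | (r : R^c) *: m == 0].

Lemma ann_submod : submod_closed ann.
Proof.
split=> [|c u v]; rewrite !inE; first by rewrite scale0r.
move=> /eqP um /eqP vm.
have -> : (c *: u + v : right_regular R) = (c : R^c) * (u : R^c) + (v : R^c).
  by [].
by rewrite scalerDl -scalerA um vm scaler0 addr0.
Qed.

HB.instance Definition _ :=
  GRing.isSubmodClosed.Build R^c (right_regular R) ann ann_submod.

End Annihilator.

Definition ann_ideal (R : pzRingType) (M : rmodType R) (m : M) : rightIdeal R :=
  ann m.

Lemma ann_idealE (R : pzRingType) (M : rmodType R) (m : M)
    (r : right_regular R) :
  (r \in ann_ideal m) = ((r : R^c) *: m == 0).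
Proof. by []. Qed.

Lemma ring_mod_scale1 (R : pzRingType) (I : rightIdeal R) (r : R) :
  (r : R^c) *: (\pi_(quotmod I) (1 : R) : ring_mod I) = \pi_(quotmod I) r.
Proof.
rewrite -[LHS]/(quotmod_scale _ _) pi_quotmod_scale.
by rewrite right_regular_scaleE mul1r.
Qed.

Lemma ring_mod_generates (R : pzRingType) (I : rightIdeal R) :
  generates (\pi_(quotmod I) (1 : R) : ring_mod I).
Proof. by elim/quotW=> r; exists r; rewrite ring_mod_scale1. Qed.

Lemma ring_mod_cyclic (R : pzRingType) (I : rightIdeal R) :
  cyclic_module (ring_mod I).
Proof. by exists (\pi_(quotmod I) (1 : R)); apply: ring_mod_generates. Qed.

Lemma ring_mod_ann_iso (R : pzRingType) (M : rmodType R) (m : M) :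
  generates m -> module_iso M (ring_mod (ann_ideal m)).
Proof.
move=> mgen.
have lin : linear (fun r : right_regular R => (r : R^c) *: m).
  move=> c u v.
  by rewrite scalerA -scalerDl.
have [phi phiE] := linear_of lin.
have phi0 v : v \in ann_ideal m -> phi v = 0.
  by rewrite phiE => /eqP.
have [h hE] := quotmod_lift phi0.
have /choice[k kE] : forall x : M, exists r : right_regular R, x = (r : R^c) *: m.
  exact: mgen.
pose g (x : M) : ring_mod (ann_ideal m) := \pi_(quotmod (ann_ideal m)) (k x).
have gK : cancel g h by move=> x; rewrite hE phiE -kE.
have hK : cancel h g.
  move=> x; rewrite -(reprK x) hE phiE; apply/eqP; rewrite pi_quotmodE.
  set r : right_regular R := repr x.
  set s := k _.
  change (((s : R^c) - (r : R^c)) *: m == 0).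
  by rewrite scalerBl -kE subrr.
have g_lin : linear g by exact: can2_linear hK gK.
have [g' g'E] := linear_of g_lin.
exists g'; exists h => x; by rewrite g'E ?gK ?hK.
Qed.

(** Trades the isomorphism in [class_of_family] for a generator inside [M]:
    an isomorphism [M -> R / I] is determined by the preimage of the coset of 1,
    whose annihilator is then [I]. *)
Lemma class_of_familyP (R : pzRingType) (F : rightIdeal R -> Prop)
    (M : rmodType R) :
  class_of_family F M <-> exists2 m : M, generates m & F (ann_ideal m).
Proof.
split=> [[I FI [h [k hK kK]]]|[m mgen Fm]]; last first.
  by exists (ann_ideal m) => //; apply: ring_mod_ann_iso.
pose m : M := k (\pi_(quotmod I) (1 : R)).
have hm r : h (r *: m) = \pi_(quotmod I) (r : R).
  by rewrite linearZ /= kK ring_mod_scale1.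
exists m.
  move=> x; have [r hx] := ring_mod_generates (h x).
  by exists r; apply: (can_inj hK); rewrite hx hm ring_mod_scale1.
suff -> : ann_ideal m = I by [].
apply: submodClosed_ext => r.
by rewrite ann_idealE -(inj_eq (can_inj hK)) hm raddf0 pi_quotmod_eq0.
Qed.

(** * From closed classes to Oka families *)

(** The hypotheses say that [A] is [phi^-1(I)] and [B] is [I + phi(V)], so the
    maps induced by [phi] and by the identity form the sequence. *)
Lemma quotmod_short_exact (K : pzRingType) (V : lmodType K)
    (A I B : submodClosed V) (phi : {linear V -> V}) :
  (forall v, (v \in A) = (phi v \in I)) ->
  (forall v, v \in B <-> exists i u, i \in I /\ v = i + phi u) ->
  exists (f : {linear quotmod A -> quotmod I})
         (g : {linear quotmod I -> quotmod B}), short_exact f g.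
Proof.
move=> AE BE.
have [piI piIE] := linear_of (@pi_quotmod_linear _ _ I).
have [piB piBE] := linear_of (@pi_quotmod_linear _ _ B).
have kerA v : v \in A -> (piI \o phi) v = 0.
  by move=> Av; rewrite /= piIE; apply/eqP; rewrite pi_quotmod_eq0 -AE.
have [f fE] := quotmod_lift kerA.
have kerI v : v \in I -> piB v = 0.
  move=> Iv; rewrite piBE; apply/eqP; rewrite pi_quotmod_eq0; apply/BE.
  by exists v, 0; rewrite raddf0 addr0.
have [g gE] := quotmod_lift kerI.
exists f, g; split.
- suff ker0 x : f x = 0 -> x = 0 by exact: raddf_inj.
  elim/quotW: x => v /eqP.
  rewrite fE /= piIE pi_quotmod_eq0 -AE => Av.
  by apply/eqP; rewrite pi_quotmod_eq0.
- elim/quotW=> v; rewrite gE piBE; split.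
    move/eqP; rewrite pi_quotmod_eq0 => /BE[i [u [Ii vE]]].
    exists (\pi_(quotmod A) u).
    rewrite fE /= piIE vE; apply/esym/eqP; rewrite pi_quotmodE.
    by rewrite addrK.
  case; elim/quotW=> u; rewrite fE /= piIE => /esym/eqP.
  rewrite pi_quotmodE => Iv; apply/eqP; rewrite pi_quotmod_eq0; apply/BE.
  by exists (v - phi u), u; rewrite subrK.
- by elim/quotW=> v; exists (\pi_(quotmod I) v); rewrite gE piBE.
Qed.

Lemma oka_short_exact (R : pzRingType) (I : rightIdeal R) (a : R) :
  exists (f : {linear ring_mod (ideal_inv I a : rightIdeal R) -> ring_mod I})
         (g : {linear ring_mod I -> ring_mod (ideal_add I a : rightIdeal R)}),
    short_exact f g.
Proof.
have lin : linear (fun r : right_regular R => a * (r : R) : right_regular R).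
  by move=> c u v; rewrite !right_regular_scaleE mulrDr mulrA.
have [phi phiE] := linear_of lin.
apply: (@quotmod_short_exact _ _ _ _ _ phi) => v; first by rewrite phiE.
split=> [/asboolP|] [i [r [Ii ->]]]; last apply/asboolP; exists i, r.
  by rewrite phiE.
by rewrite phiE.
Qed.

Lemma right_oka_family_of_class (R : pzRingType) (C : rmodType R -> Prop) :
  closed_under_extensions C -> right_oka (family_of_class C).
Proof.
move=> [C0 Cext]; split.
  by apply: C0; elim/quotW=> r; apply/eqP; rewrite pi_quotmod_eq0.
move=> I a Cadd Cinv; have [f [g fg]] := oka_short_exact I a.
by apply: (Cext _ _ _ f g) => //; apply: ring_mod_cyclic.
Qed.

(** * From Oka families to closed classes *)

(** Writing [x = y a], one has [ann x = a^-1 (ann y)], and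
    [ann y + aR = R] because [y] is in turn a multiple of [x]. *)
Lemma right_oka_generator (R : pzRingType) (F : rightIdeal R -> Prop)
    (M : rmodType R) (x y : M) :
  right_oka F -> generates x -> generates y ->
  F (ann_ideal x) -> F (ann_ideal y).
Proof.
move=> [Ftop Foka] xgen ygen Fx.
have [a xE] := ygen x; have [s yE] := xgen y.
apply: (Foka _ (a : R)).
- suff -> : (ideal_add (ann_ideal y) a : rightIdeal R) = ideal_top R by [].
  apply: submodClosed_ext => r; rewrite [RHS]inE; apply/asboolP.
  (* r = (1 - a s) r + a (s r), and 1 - a s annihilates y *)
  exists ((r : R) - (a : R) * ((s : R) * (r : R))), ((s : R) * (r : R)).
  split; last by rewrite subrK.
  rewrite ann_idealE.
  have -> : (((r : R) - (a : R) * ((s : R) * (r : R)) : R) : R^c) =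
     (r : R^c) - (r : R^c) * (s : R^c) * (a : R^c) by [].
  by rewrite scalerBl -!scalerA -xE -yE subrr.
- suff -> : (ideal_inv (ann_ideal y) a : rightIdeal R) = ann_ideal x by [].
  by apply: submodClosed_ext => r; rewrite ann_idealE xE scalerA.
Qed.

Lemma ann_inj_image (R : pzRingType) (L M : rmodType R) (f : {linear L -> M}) l :
  injective f -> ann_ideal (f l) = ann_ideal l.
Proof.
move=> f_inj; apply: submodClosed_ext => r.
by rewrite !ann_idealE -linearZ raddf_eq0.
Qed.

Lemma ideal_inv_ann (R : pzRingType) (M : rmodType R) (m : M) (a : R^c) :
  (ideal_inv (ann_ideal m) a : rightIdeal R) = ann_ideal (a *: m).
Proof. by apply: submodClosed_ext => r; rewrite ann_idealE scalerA. Qed.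

(** [r] kills [g m] exactly when [m r] lies in [ker g = f L], which is generated
    by [m a]; then [m r = m a s] says that [r - a s] kills [m]. *)
Lemma ideal_add_ann (R : pzRingType) (L M N : rmodType R)
    (f : {linear L -> M}) (g : {linear M -> N}) (l : L) (m : M) (a : R^c) :
  short_exact f g -> generates l -> f l = a *: m ->
  (ideal_add (ann_ideal m) a : rightIdeal R) = ann_ideal (g m).
Proof.
move=> [_ kerg _] lgen fl; apply: submodClosed_ext => r.
rewrite ann_idealE -linearZ; apply/asboolP/eqP => [[i [s [mi ->]]]|/kerg[x fx]].
  apply/kerg; exists ((s : R^c) *: l); rewrite linearZ /= fl.
  have -> : ((i + (a : R) * s : R) : R^c) =
    (i : R^c) + (s : R^c) * a by [].
  by rewrite scalerDl (eqP mi) add0r scalerA.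
have [s xE] := lgen x.
exists ((r : R) - (a : R) * (s : R)), (s : R); split; last by rewrite subrK.
rewrite ann_idealE.
have -> : (((r : R) - (a : R) * (s : R) : R) : R^c) =
  (r : R^c) - (s : R^c) * a by [].
by rewrite scalerBl -scalerA -fl -linearZ -xE fx subrr.
Qed.

Lemma class_of_family_extension (R : pzRingType) (F : rightIdeal R -> Prop)
    (L M N : rmodType R) (f : {linear L -> M}) (g : {linear M -> N}) :
  right_oka F -> cyclic_module M -> short_exact f g ->
  class_of_family F L -> class_of_family F N -> class_of_family F M.
Proof.
move=> Foka [m mgen] fg /class_of_familyP[l lgen Fl] /class_of_familyP[n ngen Fn].
apply/class_of_familyP; exists m => //.
have [a fl] := mgen (f l); have [f_inj _ g_surj] := fg.
have gmgen : generates (g m).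
  move=> y; have [x <-] := g_surj y; have [r ->] := mgen x.
  by exists r; rewrite linearZ.
apply: (proj2 Foka _ (a : R)).
  rewrite (ideal_add_ann fg lgen fl).
  exact: right_oka_generator ngen gmgen Fn.
by rewrite ideal_inv_ann -fl ann_inj_image.
Qed.

Theorem theorem4p7 (R : pzRingType) :
  (forall C : rmodType R -> Prop,
      cyclic_class C -> closed_under_extensions C ->
      right_oka (family_of_class C)) /\
  (forall F : rightIdeal R -> Prop,
      right_oka F ->
      cyclic_class (class_of_family F) /\
      closed_under_extensions (class_of_family F)).
Proof.
split=> [C _|F Foka]; first exact: right_oka_family_of_class.
split=> [M /class_of_familyP[m mgen _]|]; first by exists m.
split=> [Z Z0|L M N f g _ cM _ fg]; last exact: class_of_family_extension fg.
apply/class_of_familyP; exists 0.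
  by move=> x; exists 0; rewrite scale0r; apply: Z0.
suff -> : ann_ideal (0 : Z) = ideal_top R by case: Foka.
by apply: submodClosed_ext => r; rewrite ann_idealE scaler0 eqxx.
Qed.
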